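(* Let $E=0$ and assume $\gamma_{\min}^A<1<\gamma_{\max}^A<2$, $1\in I_R$ and $1\in I_K$. Then the eigenvalues of $\mathcal{P}^{-1}\mathcal{A}$ belong to $$\left[\mu_a(\gamma_{\min}^A,\gamma_{\max}^R,\gamma_{\max}^K),\ \lambda_-(\gamma_{\max}^A,\gamma_{\min}^R)\right]\cup I_+^\pi,$$ where $$I_+^\pi=\left[\mu_b(\gamma_{\min}^A,\gamma_{\max}^R,\gamma_{\min}^K),\ \max\{\mu_c(\gamma_{\max}^A,\gamma_{\min}^R,\gamma_{\max}^K),\ \mu_c(\gamma_{\max}^A,\gamma_{\max}^R,\gamma_{\max}^K),\ \beta_c(\gamma_{\max}^A,\gamma_{\max}^K)\}\right]$$ and $\beta_c(\gamma_A,\gamma_K)=\min\left\{\frac{1}{2-\gamma_A},\ \gamma_K+\sqrt{\gamma_K^2+\gamma_K}\right\}$.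
   Context: Let $n\ge m\ge p$ be positive integers, $A\in\mathbb{R}^{n\times n}$ symmetric positive definite (SPD), $B\in\mathbb{R}^{m\times n}$ and $C\in\mathbb{R}^{p\times m}$ of full row rank. With $E=0$, $$\mathcal{A}=\begin{bmatrix}A&B^\top&0\\ B&0&C^\top\\ 0&C&0\end{bmatrix}.$$ Let $\widehat A$ be an SPD approximation of $A$; $\widetilde S=B\widehat A^{-1}B^\top$ and $\widehat S$ an SPD approximation of $\widetilde S$; $\widetilde X=C\widehat S^{-1}C^\top$ and $\widehat X$ an SPD approximation of $\widetilde X$ (each hatted matrix is an SPD matrix of the appropriate size). The preconditioner is $\mathcal{P}=\mathcal{P}_L\mathcal{P}_D^{-1}\mathcal{P}_L^\top$ with $$\mathcal{P}_L=\begin{bmatrix}\widehat A&0&0\\ B&-\widehat S&0\\ 0&C&\widehat X\end{bmatrix},\qquad \mathcal{P}_D=\begin{bmatrix}\widehat A&0&0\\ 0&\widehat S&0\\ 0&0&\widehat X\end{bmatrix}.$$ Put $K=\widehat X^{-1/2}C\widehat S^{-1/2}$ and define the intervals $I_A=[\gamma_{\min}^A,\gamma_{\max}^A]$, $I_R=[\gamma_{\min}^R,\gamma_{\max}^R]$, $I_K=[\gamma_{\min}^K,\gamma_{\max}^K]$, whose endpoints are the smallest and largest eigenvalues of $\widehat A^{-1}A$, of $\widehat S^{-1}\widetilde S$, and of $KK^\top$, respectively. Define $p(\lambda;\gamma_A,\gamma_R)=\lambda^2-\lambda(\gamma_A\gamma_R+\gamma_A-2\gamma_R)-\gamma_R$,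 with roots $\lambda_\pm(\gamma_A,\gamma_R)=\eta\pm\sqrt{\eta^2+\gamma_R}$, $\eta=\tfrac12(\gamma_R+1)\gamma_A-\gamma_R$, and $$\pi(\lambda;\gamma_A,\gamma_R,\gamma_K)=(1+\lambda)^2(\gamma_A-\lambda)\gamma_K+p(\lambda;\gamma_A,\gamma_R)\,\lambda\,(1+\gamma_K).$$ For $\gamma_A\in I_A\setminus\{1\}$, $\gamma_R\in I_R$, $\gamma_K\in I_K$, this cubic in $\lambda$ has three distinct real roots, denoted $\mu_a(\gamma_A,\gamma_R,\gamma_K)<0<\mu_b(\gamma_A,\gamma_R,\gamma_K)<\mu_c(\gamma_A,\gamma_R,\gamma_K)$. *)

(* Defs.v *)
From HB Require Import structures.
From mathcomp Require Import all_boot all_order all_algebra.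
From mathcomp Require Import polyrcf complex reals.

Set Implicit Arguments.
Unset Strict Implicit.
Unset Printing Implicit Defensive.

Import Order.TTheory GRing.Theory Num.Theory.

Local Open Scope ring_scope.

Definition spd (R : rcfType) (n : nat) (M : 'M[R]_n) : Prop :=
  M^T = M /\ forall x : 'cV[R]_n, x != 0 -> 0 < (x^T *m M *m x) 0 0.

(* T = M^{1/2}: for M SPD, exactly one SPD matrix T satisfies T^2 = M. *)
Definition is_spd_sqrt (R : rcfType) (n : nat) (T M : 'M[R]_n) : Prop :=
  spd T /\ T *m T = M.

(* These are used only for matrices similar to a symmetric matrix, so no
   non-real eigenvalue is overlooked. *)
Definition is_min_eigenvalue (R : rcfType) (n : nat) (M : 'M[R]_n) (g : R) :=
  eigenvalue M g /\ forall l : R, eigenvalue M l -> g <= l.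

Definition is_max_eigenvalue (R : rcfType) (n : nat) (M : 'M[R]_n) (g : R) :=
  eigenvalue M g /\ forall l : R, eigenvalue M l -> l <= g.

Section Blocks.
Variables (R : rcfType) (n m p : nat).

Definition block3_mx
    (M11 : 'M[R]_(n, n)) (M12 : 'M[R]_(n, m)) (M13 : 'M[R]_(n, p))
    (M21 : 'M[R]_(m, n)) (M22 : 'M[R]_(m, m)) (M23 : 'M[R]_(m, p))
    (M31 : 'M[R]_(p, n)) (M32 : 'M[R]_(p, m)) (M33 : 'M[R]_(p, p)) :
    'M[R]_(n + m + p) :=
  block_mx (block_mx M11 M12 M21 M22) (col_mx M13 M23) (row_mx M31 M32) M33.

Definition saddle_mx (A : 'M[R]_n) (B : 'M[R]_(m, n)) (C : 'M[R]_(p, m)) :=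
  block3_mx A B^T 0
            B 0   C^T
            0 C   0.

Definition precond_L (Ah : 'M[R]_n) (Sh : 'M[R]_m) (Xh : 'M[R]_p)
    (B : 'M[R]_(m, n)) (C : 'M[R]_(p, m)) :=
  block3_mx Ah 0      0
            B  (- Sh) 0
            0  C      Xh.

Definition precond_D (Ah : 'M[R]_n) (Sh : 'M[R]_m) (Xh : 'M[R]_p) :=
  block3_mx Ah 0  0
            0  Sh 0
            0  0  Xh.

Definition precond (Ah : 'M[R]_n) (Sh : 'M[R]_m) (Xh : 'M[R]_p)
    (B : 'M[R]_(m, n)) (C : 'M[R]_(p, m)) :=
  precond_L Ah Sh Xh B C *m invmx (precond_D Ah Sh Xh)
    *m (precond_L Ah Sh Xh B C)^T.

End Blocks.

Section Polynomials.
Variable R : rcfType.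
Implicit Types gA gR gK : R.

Definition p_poly gA gR : {poly R} :=
  'X^2 - (gA * gR + gA - 2 * gR) *: 'X - gR%:P.

Definition eta gA gR : R := 2^-1 * (gR + 1) * gA - gR.

Definition lambda_minus gA gR : R :=
  eta gA gR - Num.sqrt (eta gA gR ^+ 2 + gR).

Definition pi_poly gA gR gK : {poly R} :=
  gK *: ((1 + 'X) ^+ 2 * (gA%:P - 'X)) + (1 + gK) *: (p_poly gA gR * 'X).

(* [rootsR] lists the distinct real roots in increasing order.  For
   gA, gR, gK > 0 and gA != 1 the cubic has leading coefficient 1, is positive
   at 0 and negative at gA, so there are three roots mu_a < 0 < mu_b < mu_c. *)
Definition mu_a gA gR gK : R := (rootsR (pi_poly gA gR gK))`_0.
Definition mu_b gA gR gK : R := (rootsR (pi_poly gA gR gK))`_1.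
Definition mu_c gA gR gK : R := (rootsR (pi_poly gA gR gK))`_2.

Definition beta_c gA gK : R :=
  Num.min (2 - gA)^-1 (gK + Num.sqrt (gK ^+ 2 + gK)).

End Polynomials.

(* Main.v *)
(* Since the preconditioner is positive definite, an eigenvalue l is real and
   has a real eigenvector (x, y, z) of the pencil.  For l outside
   [gAmin, gAmax] the matrix A - l Ah is definite, so x can be eliminated.
   For l < 0 and for l > gAmax one then eliminates z, and for 0 < l < gAmin the
   Schur complement in y is definite and y is eliminated instead.  Rayleigh
   quotient bounds in place of the three eigenvalue parameters, together with
   monotonicity in those parameters, give the sign of the cubic [pi] (or of the
   quadratic [p]) at l for extremal parameters, which locates l among the
   roots.  For l in [gAmin, gAmax] there is nothing to do because
   pi(gA; gA, gR, gK) < 0, i.e. mu_b < gA < mu_c. *)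
Require Import Defs.
From HB Require Import structures.
From mathcomp Require Import all_boot all_order all_algebra.
From mathcomp Require Import polyrcf complex classical_sets reals.
From mathcomp Require Import ring lra.

Set Implicit Arguments.
Unset Strict Implicit.
Unset Printing Implicit Defensive.

Import Order.TTheory GRing.Theory Num.Theory.

Local Open Scope ring_scope.

(** * Positive definite matrices *)

Section Dot.
Variable R : rcfType.
Implicit Type n : nat.

Definition dot n (x y : 'cV[R]_n) : R := (x^T *m y) 0 0.

Lemma dotE n (x y : 'cV[R]_n) : dot x y = \sum_i x i 0 * y i 0.
Proof. by rewrite /dot mxE; apply: eq_bigr => i _; rewrite mxE. Qed.

Lemma dotC n (x y : 'cV[R]_n) : dot x y = dot y x.
Proof. by rewrite !dotE; apply: eq_bigr => i _; rewrite mulrC. Qed.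

Lemma dotDr n (x y z : 'cV[R]_n) : dot x (y + z) = dot x y + dot x z.
Proof. by rewrite /dot mulmxDr mxE. Qed.

Lemma dotDl n (x y z : 'cV[R]_n) : dot (x + y) z = dot x z + dot y z.
Proof. by rewrite dotC dotDr !(dotC z). Qed.

Lemma dotZr n a (x y : 'cV[R]_n) : dot x (a *: y) = a * dot x y.
Proof. by rewrite /dot -scalemxAr mxE. Qed.

Lemma dotZl n a (x y : 'cV[R]_n) : dot (a *: x) y = a * dot x y.
Proof. by rewrite dotC dotZr dotC. Qed.

Lemma dotNr n (x y : 'cV[R]_n) : dot x (- y) = - dot x y.
Proof. by rewrite -scaleN1r dotZr mulN1r. Qed.

Lemma dotBr n (x y z : 'cV[R]_n) : dot x (y - z) = dot x y - dot x z.
Proof. by rewrite dotDr dotNr. Qed.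

Lemma dot0r n (x : 'cV[R]_n) : dot x 0 = 0.
Proof. by rewrite /dot mulmx0 mxE. Qed.

Lemma dot_mulmx m n (M : 'M[R]_(m, n)) x y :
  dot x (M *m y) = dot (M^T *m x) y.
Proof. by rewrite /dot trmx_mul trmxK mulmxA. Qed.

Lemma dot_sym n (M : 'M[R]_n) x y :
  M^T = M -> dot x (M *m y) = dot y (M *m x).
Proof. by move=> sM; rewrite dot_mulmx sM dotC. Qed.

Lemma dot_ge0 n (x : 'cV[R]_n) : 0 <= dot x x.
Proof. by rewrite dotE sumr_ge0 // => i _; rewrite -expr2 sqr_ge0. Qed.

Lemma dot_eq0 n (x : 'cV[R]_n) : dot x x = 0 -> x = 0.
Proof.
rewrite dotE => /eqP; rewrite psumr_eq0 => [/allP x0|i _]; last first.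
  by rewrite -expr2 sqr_ge0.
apply/colP => i; rewrite mxE; apply/eqP.
by have := x0 i; rewrite mem_index_enum -expr2 sqrf_eq0 => /(_ isT).
Qed.

(* Evaluating the nonnegative polynomial [a + 2 b t + c t^2] at its minimiser. *)
Lemma quadratic_discr (a b c : R) : 0 <= c ->
  (forall t, 0 <= a + 2 * b * t + c * t ^+ 2) -> b ^+ 2 <= a * c.
Proof.
rewrite le_eqVlt => /predU1P[<-|c0] pos; last first.
  have := pos (- (b / c)); rewrite -(pmulr_rge0 _ c0).
  have -> : c * (a + 2 * b * - (b / c) + c * (- (b / c)) ^+ 2) = a * c - b ^+ 2.
    by field; rewrite gt_eqF.
  by rewrite subr_ge0.
have [->|b0] := eqVneq b 0; first by rewrite expr0n mulr0.
have := pos (- (a + 1) / (2 * b)).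
have -> : a + 2 * b * (- (a + 1) / (2 * b)) + 0 * (- (a + 1) / (2 * b)) ^+ 2
   = -1 by field.
by rewrite oppr_ge0 ler10.
Qed.

Lemma psd_cauchy n (M : 'M[R]_n) x y : M^T = M ->
  (forall x, 0 <= dot x (M *m x)) ->
  dot x (M *m y) ^+ 2 <= dot x (M *m x) * dot y (M *m y).
Proof.
move=> sM pM; apply: quadratic_discr => // t.
have := pM (x + t *: y).
rewrite mulmxDr -scalemxAr !dotDl !dotDr !dotZl !dotZr (dot_sym y x sM).
by congr (0 <= _); ring.
Qed.

(** If the form vanishes at [x], Cauchy-Schwarz between [M *m x] and [x] makes the squared norm of
    [M *m x] vanish, and invertibility of [M] then gives [x = 0]. *)
Lemma psd_unit_spd n (M : 'M[R]_n) : M^T = M ->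
  (forall x, 0 <= dot x (M *m x)) -> M \in unitmx -> spd M.
Proof.
move=> sM pM uM; split=> // x x0; rewrite -mulmxA -/(dot x (M *m x)).
rewrite lt_neqAle pM andbT eq_sym; apply: contraNneq x0 => q0.
have := psd_cauchy (M *m x) x sM pM.
rewrite q0 mulr0 exprn_even_le0 //= => /eqP/dot_eq0 Mx0.
by rewrite -[x](mulKmx uM) Mx0 mulmx0.
Qed.

Lemma spd_gt0 n (M : 'M[R]_n) x : spd M -> x != 0 -> 0 < dot x (M *m x).
Proof. by case=> _ pM x0; rewrite /dot mulmxA pM. Qed.

Lemma spd_ge0 n (M : 'M[R]_n) x : spd M -> 0 <= dot x (M *m x).
Proof.
move=> sM; have [->|x0] := eqVneq x 0; first by rewrite mulmx0 dot0r.
exact/ltW/spd_gt0.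
Qed.

Lemma spd_cauchy n (M : 'M[R]_n) x y : spd M ->
  dot x (M *m y) ^+ 2 <= dot x (M *m x) * dot y (M *m y).
Proof. by move=> sM; apply: psd_cauchy => [|u]; [case: sM|apply: spd_ge0]. Qed.

Lemma unitmx_ker n (M : 'M[R]_n) :
  (forall x : 'cV_n, M *m x = 0 -> x = 0) -> M \in unitmx.
Proof.
move=> kM; rewrite -unitmx_tr -row_free_unit -kermx_eq0.
apply/rowV0P => v /sub_kermxP vM; apply: trmx_inj; rewrite trmx0; apply: kM.
by rewrite -[M]trmxK -trmx_mul vM trmx0.
Qed.

Lemma spd_unit n (M : 'M[R]_n) : spd M -> M \in unitmx.
Proof.
move=> sM; apply: unitmx_ker => x Mx0; apply/eqP/negPn/negP => x0.
by have := spd_gt0 sM x0; rewrite Mx0 dot0r ltxx.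
Qed.

Lemma spd_inv n (M : 'M[R]_n) : spd M -> spd (invmx M).
Proof.
move=> sM; have uM := spd_unit sM; have sMi : (invmx M)^T = invmx M.
  by rewrite trmx_inv; case: sM => ->.
apply: psd_unit_spd => // [x|]; last by rewrite unitmx_inv.
rewrite -{1}[x](mulKVmx uM) dotC; case: (sM) => sMT _.
exact: (spd_ge0 (invmx M *m x) sM).
Qed.

Lemma spdD n (M N : 'M[R]_n) : spd M -> spd N -> spd (M + N).
Proof.
move=> sM sN; split=> [|x x0]; first by rewrite raddfD /= sM.1 sN.1.
by rewrite mulmxDr mulmxDl mxE addr_gt0 // ?(sM.2 _ x0) ?(sN.2 _ x0).
Qed.

Lemma spdZ n a (M : 'M[R]_n) : 0 < a -> spd M -> spd (a *: M).
Proof.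
move=> a0 sM; split=> [|x x0]; first by rewrite linearZ /= sM.1.
by rewrite -scalemxAr -scalemxAl mxE mulr_gt0 // (sM.2 _ x0).
Qed.

Lemma trmx_mul_row_free m n (B : 'M[R]_(m, n)) (y : 'cV_m) :
  row_free B -> B^T *m y = 0 -> y = 0.
Proof.
move=> fB By0; apply: trmx_inj; rewrite trmx0; apply: (row_free_inj fB).
by rewrite mul0mx -[B]trmxK -trmx_mul By0 trmx0.
Qed.

Lemma spd_congr m n (B : 'M[R]_(m, n)) (M : 'M[R]_n) :
  row_free B -> spd M -> spd (B *m M *m B^T).
Proof.
move=> fB sM; split=> [|x x0].
  by rewrite !trmx_mul trmxK sM.1 mulmxA.
rewrite -mulmxA -!mulmxA -/(dot _ _) dot_mulmx; apply: spd_gt0 => //.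
by apply: contraNneq x0 => /(trmx_mul_row_free fB) ->.
Qed.

(** Inversion reverses the Loewner order. With [u = invmx N *m w] and [v = invmx M *m w], expand the
    nonnegative [M]-form of [v - c u], namely [w.v - 2c w.u + c^2 u.Mu], and bound [c u.Mu] by
    [u.Nu = w.u]. *)
Lemma spd_inv_le n (M N : 'M[R]_n) c w : 0 < c -> spd M -> spd N ->
  (forall x, c * dot x (M *m x) <= dot x (N *m x)) ->
  c * dot w (invmx N *m w) <= dot w (invmx M *m w).
Proof.
move=> c0 sM sN leMN.
have uM := spd_unit sM; have uN := spd_unit sN.
set u := invmx N *m w; set v := invmx M *m w.
have Nu : N *m u = w by rewrite /u mulKVmx.
have Mv : M *m v = w by rewrite /v mulKVmx.
have := spd_ge0 (v - c *: u) sM; rewrite mulmxBr -scalemxAr Mv.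
rewrite dotBr dotZr dotC dotBr dotZr [dot _ (M *m u)]dotC.
rewrite dotDr -scaleN1r dotZr dotZr !(dotC (M *m u)) (dot_sym v u sM.1) Mv.
have := leMN u; rewrite Nu -(ler_pM2l c0) (dotC u w).
move: (dot w u) (dot w v) (dot u (M *m u)) => wu wv uMu; lra.
Qed.

(* Cauchy-Schwarz in the inner product of [S] against [invmx S *m delta_mx i 0]
   bounds each squared entry of [x] by [(invmx S) i i * x^T S x]. *)
Lemma spd_dominates n (S N : 'M[R]_n) : spd S ->
  exists2 c, 0 < c & forall x, dot x (N *m x) <= c * dot x (S *m x).
Proof.
move=> sS; have uS := spd_unit sS.
pose e i : 'cV[R]_n := delta_mx i 0.
pose d i := dot (invmx S *m e i) (S *m (invmx S *m e i)).
have d0 i : 0 <= d i by apply: spd_ge0.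
have xd (x : 'cV[R]_n) i : x i 0 ^+ 2 <= d i * dot x (S *m x).
  have -> : x i 0 = dot (invmx S *m e i) (S *m x).
    rewrite (dot_sym _ _ sS.1) mulKVmx // dotE (bigD1 i) //= big1 => [|j ji].
      by rewrite !mxE !eqxx mulr1 addr0.
    by rewrite !mxE (negbTE ji) mulr0.
  exact: spd_cauchy.
exists (1 + \sum_i \sum_j `|N i j| * (d i + d j)).
  rewrite ltr_pwDl // sumr_ge0 // => i _; rewrite sumr_ge0 // => j _.
  by rewrite mulr_ge0 ?addr_ge0.
move=> x; have q0 := spd_ge0 x sS.
rewrite mulrDl mul1r -[leLHS]add0r; apply: lerD => //.
rewrite dotE mulr_suml; apply: ler_sum => i _.
rewrite mxE mulr_sumr mulr_suml; apply: ler_sum => j _.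
have := xd x i; have := xd x j; have := q0.
move: (dot x _) (d i) (d j) (x i 0) (x j 0) (N i j) => q di dj a b k q0' bq aq.
rewrite -[leRHS]mulrA.
apply: (le_trans (ler_norm _)); rewrite mulrCA normrM; apply: ler_wpM2l => //.
apply: (@le_trans _ _ (a ^+ 2 + b ^+ 2)); last by rewrite mulrDl lerD.
by rewrite ler_norml; apply/andP; split; nra.
Qed.

End Dot.

(** * Symmetric definite pencils *)

Section Eigen.
Variable R : realType.
Implicit Type n : nat.

Lemma pencil_unit n (N M : 'M[R]_n) t : N \in unitmx ->
  ~~ eigenvalue (invmx N *m M) t -> t *: N - M \in unitmx.
Proof.
move=> uN; rewrite negbK /eigenspace kermx_eq0 row_free_unit => uE.
have -> : t *: N - M = - (N *m (invmx N *m M - t%:M)).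
  by rewrite mulmxBr mulKVmx // mul_mx_scalar opprB.
by rewrite -mulmxN unitmx_mul uN -scaleN1r unitmxZ // unitrN1.
Qed.

(* Let [t] be the least value with [M <= t N].  If [t > g], then [t N - M] is
   positive semidefinite and nonsingular, hence definite, and [t] can be
   decreased. *)
Lemma rayleigh_le n (N M : 'M[R]_n) g : spd N -> M^T = M ->
  (forall l, eigenvalue (invmx N *m M) l -> l <= g) ->
  forall x, dot x (M *m x) <= g * dot x (N *m x).
Proof.
move=> sN sM gmax.
pose S := [set t | g <= t /\ forall x, dot x (M *m x) <= t * dot x (N *m x)]%classic.
have Slb : has_lbound S by exists g => t [].
have S0 : nonempty S.
  have [c c0 Mc] := spd_dominates M sN.
  exists (Num.max g c); split=> [|x]; first by rewrite le_max lexx.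
  apply: le_trans (Mc x) _; apply: ler_wpM2r; first exact: spd_ge0.
  by rewrite le_max lexx orbT.
set t := inf S; have gt : g <= t by apply: lb_le_inf => // s [].
(* The infimum is itself admissible: for each nonzero [x] the Rayleigh quotient is a lower bound of
   [S]. *)
have tM x : dot x (M *m x) <= t * dot x (N *m x).
  have [->|x0] := eqVneq x 0; first by rewrite !mulmx0 !dot0r mulr0.
  rewrite -ler_pdivrMr ?spd_gt0 //; apply: lb_le_inf => // s [_ sM'].
  by rewrite ler_pdivrMr ?spd_gt0.
move: gt; rewrite le_eqVlt => /predU1P[->//|gt].
have formE s (x : 'cV[R]_n) :
    dot x ((s *: N - M) *m x) = s * dot x (N *m x) - dot x (M *m x).
  by rewrite mulmxBl -scalemxAl dotBr dotZr.
have sD : spd (t *: N - M).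
  apply: psd_unit_spd => [|x|].
  - by rewrite linearB linearZ /= sM sN.1.
  - by rewrite formE subr_ge0.
  - apply: pencil_unit; first exact: spd_unit.
    by apply/negP => /gmax; rewrite leNgt gt.
(* The bound of [N] by [c (t N - M)] rearranges to [M <= (t - c^-1) N], which quantifies the
   decrease; the maximum with [g] keeps the new value in [S]. *)
have [c c0 Nc] := spd_dominates N sD.
have : t <= Num.max g (t - c^-1).
  apply: ge_inf => //; split=> [|x]; first by rewrite le_max lexx.
  apply: (@le_trans _ _ ((t - c^-1) * dot x (N *m x))).
    have := Nc x; rewrite formE mulrBl -ler_pdivrMl //; lra.
  apply: ler_wpM2r; first exact: spd_ge0.
  by rewrite le_max lexx orbT.
by rewrite le_max leNgt gt /= leNgt gtrBl invr_gt0 c0.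
Qed.

Lemma rayleigh_ge n (N M : 'M[R]_n) g : spd N -> M^T = M ->
  (forall l, eigenvalue (invmx N *m M) l -> g <= l) ->
  forall x, g * dot x (N *m x) <= dot x (M *m x).
Proof.
move=> sN sM gmin x.
have := @rayleigh_le n N (- M) (- g) sN _ _ x.
rewrite mulNmx dotNr mulNr lerN2; apply; first by rewrite linearN /= sM.
move=> l /eigenvalueP[v vE v0]; rewrite lerNr; apply: gmin.
apply/eigenvalueP; exists v => //.
by rewrite scaleNr -vE mulmxN mulmxN opprK.
Qed.

(** [eigenvalue] provides a row vector [v]. Transposing its equation gives [M N^-1 v^T = l v^T], so
    the column vector sought is [N^-1 v^T]. *)
Lemma eigenvalue_pencil n (N M : 'M[R]_n) l : spd N -> M^T = M ->
  eigenvalue (invmx N *m M) l ->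
  exists2 x : 'cV_n, x != 0 & M *m x = l *: (N *m x).
Proof.
move=> sN sM /eigenvalueP[v vE v0]; have uN := spd_unit sN.
have sNi := (spd_inv sN).1.
exists (invmx N *m v^T).
  apply: contraNneq v0 => /(canRL (mulKVmx uN)).
  by rewrite mulmx0 => /(canRL trmxK); rewrite trmx0 => ->.
rewrite mulKVmx // -linearZ -vE /=.
by rewrite !trmx_mul sNi sM mulmxA.
Qed.

Lemma spd_pencil_eigenvalue_gt0 n (N M : 'M[R]_n) l : spd N -> spd M ->
  eigenvalue (invmx N *m M) l -> 0 < l.
Proof.
move=> sN sM /(eigenvalue_pencil sN sM.1)[x x0 xE].
by have := spd_gt0 sM x0; rewrite xE dotZr pmulr_lgt0 // spd_gt0.
Qed.

(** * Reality of the spectrum of a definite pencil *)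

Lemma map_Re_mul m n k (w : 'M[R[i]]_(m, n)) (M : 'M[R]_(n, k)) :
  map_mx (@complex.Re R) (w *m map_mx (real_complex R) M) =
  map_mx (@complex.Re R) w *m M.
Proof.
apply/matrixP => i j; rewrite !mxE raddf_sum; apply: eq_bigr => h _.
by rewrite !mxE; case: (w i h) => a b /=; rewrite mulr0 subr0.
Qed.

Lemma map_Im_mul m n k (w : 'M[R[i]]_(m, n)) (M : 'M[R]_(n, k)) :
  map_mx (@complex.Im R) (w *m map_mx (real_complex R) M) =
  map_mx (@complex.Im R) w *m M.
Proof.
apply/matrixP => i j; rewrite !mxE raddf_sum; apply: eq_bigr => h _.
by rewrite !mxE; case: (w i h) => a b /=; rewrite mulr0 add0r.
Qed.

(* For an eigenvector [u + i v] with eigenvalue [a + i b], the symmetry of [S]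
   gives [b (u^T P u + v^T P v) = 0]. *)
Lemma complex_pencil_eigenvalue n (P S : 'M[R]_n) z : spd P -> S^T = S ->
  eigenvalue (map_mx (real_complex R) (invmx P *m S)) z ->
  exists2 l, z = real_complex R l &
    exists2 x : 'cV_n, x != 0 & S *m x = l *: (P *m x).
Proof.
move=> sP sS /eigenvalueP[v vE v0]; have uP := spd_unit sP.
pose u1 := map_mx (@complex.Re R) v *m invmx P.
pose u2 := map_mx (@complex.Im R) v *m invmx P.
case: z vE => a b vE.
have E1 : u1 *m S = a *: (u1 *m P) - b *: (u2 *m P).
  rewrite -mulmxA -map_Re_mul vE !mulmxKV //.
  by apply/rowP => i; rewrite !mxE; case: (v 0 i).
have E2 : u2 *m S = b *: (u1 *m P) + a *: (u2 *m P).
  rewrite -mulmxA -map_Im_mul vE !mulmxKV //.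
  by apply/rowP => i; rewrite !mxE; case: (v 0 i) => c d /=; rewrite addrC.
have F1 : S *m u1^T = a *: (P *m u1^T) - b *: (P *m u2^T).
  by rewrite -{1}sS -trmx_mul E1 linearB !linearZ /= !trmx_mul sP.1.
have F2 : S *m u2^T = b *: (P *m u1^T) + a *: (P *m u2^T).
  by rewrite -{1}sS -trmx_mul E2 linearD !linearZ /= !trmx_mul sP.1.
have u12 : (u1^T != 0) || (u2^T != 0).
  rewrite -negb_and; apply: contraNN v0 => /andP[/eqP z1 /eqP z2].
  have zero w : (w *m invmx P)^T = 0 -> w = 0 :> 'rV_n.
    by move/(canRL trmxK)/(canRL (mulmxKV uP)); rewrite trmx0 mul0mx.
  apply/eqP/rowP => i; have /rowP/(_ i) := zero _ z1.
  have /rowP/(_ i) := zero _ z2.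
  by rewrite !mxE; case: (v 0 i) => c d /= -> ->.
have p1 := spd_ge0 u1^T sP; have p2 := spd_ge0 u2^T sP.
have sum_gt0 : 0 < dot u1^T (P *m u1^T) + dot u2^T (P *m u2^T).
  by case/orP: u12 => nz; [apply: ltr_pwDl|apply: ltr_wpDl] => //; apply: spd_gt0.
have b0 : b = 0.
  have := dot_sym u1^T u2^T sS; rewrite F1 F2 dotBr dotDr !dotZr.
  rewrite (dot_sym u1^T u2^T sP.1) => E; apply/eqP.
  rewrite -(mulIr_eq0 _ (mulIf (lt0r_neq0 sum_gt0))); apply/eqP; lra.
exists a; first by rewrite b0.
by case/orP: u12 => nz; [exists u1^T|exists u2^T] => //;
  rewrite ?F1 ?F2 b0 scale0r ?subr0 ?add0r.
Qed.

End Eigen.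

(** * The cubic pi *)

Section Cubic.
Variable R : rcfType.
Implicit Types a b c x gA gR gK : R.

Definition cubic a b c : {poly R} := 'X^3 + a *: 'X^2 + b *: 'X + c%:P.

Lemma size_cubic a b c : size (cubic a b c) = 4.
Proof.
rewrite /cubic -!addrA size_polyDl ?size_polyXn //.
rewrite addrA (leq_ltn_trans (size_polyD _ _)) // gtn_max.
rewrite (leq_ltn_trans (size_polyC_leq1 _)) // andbT.
rewrite (leq_ltn_trans (size_polyD _ _)) // gtn_max.
rewrite (leq_ltn_trans (size_scale_leq _ _)) ?size_polyXn //.
by rewrite (leq_ltn_trans (size_scale_leq _ _)) ?size_polyX.
Qed.

Lemma lead_coef_cubic a b c : lead_coef (cubic a b c) = 1.
Proof.
by rewrite lead_coefE size_cubic !coefD !coefZ !coefXn coefX coefC /= !mulr0 !addr0.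
Qed.

Lemma horner_cubic a b c x :
  (cubic a b c).[x] = x ^+ 3 + a * x ^+ 2 + b * x + c.
Proof. by rewrite !hornerE. Qed.

(** [M] exceeds the sum of the absolute values of the coefficients and is at least 1, so [M^3]
    dominates the lower terms; adding [|d|] pushes it beyond [d]. *)
Lemma cubic_tails a b c d : exists2 M, d < M &
  (cubic a b c).[- M] < 0 < (cubic a b c).[M].
Proof.
pose M := 1 + `|a| + `|b| + `|c| + `|d|; exists M.
  rewrite (le_lt_trans (ler_norm d)) // /M ltrDr.
  by rewrite -!addrA ltr_pwDl // !addr_ge0.
have M1 : 1 <= M by rewrite /M -!addrA lerDl !addr_ge0.
have bnd k e : (k <= 2)%N -> `|e * M ^+ k| <= `|e| * M ^+ 2.
  move=> k2; rewrite normrM ler_wpM2l // ger0_norm; first exact: ler_weXn2l.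
  by rewrite exprn_ge0 // (le_trans ler01).
have sum_lt : `|a * M ^+ 2| + `|b * M| + `|c| < M ^+ 3.
  rewrite -[X in X < _]addrA.
  apply: (@le_lt_trans _ _ ((`|a| + `|b| + `|c|) * M ^+ 2)).
    rewrite !mulrDl -addrA; apply: lerD; first exact: bnd.
    by apply: lerD; [exact: (bnd 1%N)|rewrite -{1}[c]mulr1; exact: (bnd 0%N)].
  rewrite [ltRHS]exprS ltr_pM2r ?exprn_gt0 ?(lt_le_trans ltr01) //.
  by rewrite /M; have := normr_ge0 d; lra.
rewrite !horner_cubic sqrrN exprNn mulrN.
have -> : (-1) ^+ 3 = -1 :> R by rewrite !exprS expr0; ring.
move: sum_lt; rewrite -normrN.
have := ler_norm (- (a * M ^+ 2)); have := ler_norm (b * M).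
have := ler_norm c; have := ler_norm (- c); rewrite normrN.
have := ler_norm (a * M ^+ 2); have := ler_norm (- (b * M)); rewrite !normrN.
lra.
Qed.

(** The cubic terms contribute [- gK] and [1 + gK], so the polynomial is monic. *)
Lemma pi_polyE gA gR gK : pi_poly gA gR gK =
  cubic (gK * (gA - 2) - (1 + gK) * (gA * gR + gA - 2 * gR))
        (gK * (2 * gA - 1) - (1 + gK) * gR) (gK * gA).
Proof.
rewrite /pi_poly /p_poly /cubic -!mul_polyC.
rewrite !(polyCB, polyCD, polyCM, polyC1, polyC_natr); ring.
Qed.

Lemma horner_pi gA gR gK x : (pi_poly gA gR gK).[x] =
  gK * ((1 + x) ^+ 2 * (gA - x)) +
  (1 + gK) * ((x ^+ 2 - (gA * gR + gA - 2 * gR) * x - gR) * x).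
Proof. by rewrite pi_polyE horner_cubic; ring. Qed.

(** The signs at [- M], [0], [gA] and [M] alternate, starting with minus; at [gA] the value is
    [- (1 + gK) gR gA (gA - 1)^2]. The intermediate value theorem gives one root per gap, and the
    monic factorization lets later lemmas locate a point from the sign of the cubic. *)
Lemma pi_roots gA gR gK : 0 < gA -> gA != 1 -> 0 < gR -> 0 < gK ->
  exists a b c, [/\ a < 0, 0 < b < gA, gA < c,
    rootsR (pi_poly gA gR gK) = [:: a; b; c] &
    forall x, (pi_poly gA gR gK).[x] = (x - a) * (x - b) * (x - c)].
Proof.
move=> gA0 gA1 gR0 gK0; set q := pi_poly gA gR gK.
have [M gAM /andP[qN qP]] : exists2 M, gA < M & q.[- M] < 0 < q.[M].
  by rewrite /q pi_polyE; apply: cubic_tails.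
have q0 : 0 < q.[0].
  by rewrite horner_pi !(mulr0, addr0, subr0) expr1n mul1r mulr_gt0.
have qA : q.[gA] < 0.
  rewrite horner_pi subrr !mulr0 add0r.
  have -> : (1 + gK) * ((gA ^+ 2 - (gA * gR + gA - 2 * gR) * gA - gR) * gA) =
    - ((1 + gK) * gR * gA * (gA - 1) ^+ 2) by ring.
  rewrite oppr_lt0 mulr_gt0 ?exprn_even_gt0 ?subr_eq0 //.
  by rewrite !mulr_gt0 // addr_gt0.
have M0 : 0 < M by apply: lt_trans gAM.
have Mn0 : - M < 0 by rewrite oppr_lt0.
have sa : q.[- M] * q.[0] < 0 by rewrite nmulr_rlt0.
have sb : q.[0] * q.[gA] < 0 by rewrite pmulr_rlt0.
have sc : q.[gA] * q.[M] < 0 by rewrite nmulr_rlt0.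
have [a] := poly_ivtoo (ltW Mn0) sa; rewrite in_itv /= => /andP[_ a0] ra.
have [b] := poly_ivtoo (ltW gA0) sb; rewrite in_itv /= => b0A rb.
have [c] := poly_ivtoo (ltW gAM) sc; rewrite in_itv /= => /andP[cA _] rc.
have [b0 bA] := andP b0A.
have ab := lt_trans a0 b0; have bc := lt_trans bA cA; have ac := lt_trans ab bc.
have qE : q = ('X - a%:P) * ('X - b%:P) * ('X - c%:P).
  rewrite {1}(@all_roots_prod_XsubC _ q [:: a; b; c]).
  - rewrite /q pi_polyE lead_coef_cubic scale1r.
    by rewrite !big_cons big_nil mulr1 mulrA.
  - by rewrite /q pi_polyE size_cubic.
  - by rewrite /= ra rb rc.
  - by rewrite uniq_rootsE /= !inE (lt_eqF ab) (lt_eqF ac) (lt_eqF bc).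
have qx x : q.[x] = (x - a) * (x - b) * (x - c) by rewrite qE !hornerE.
exists a, b, c; split=> //; apply: lt_sorted_eq; first exact: sorted_roots.
  by rewrite /= ab bc.
have qn0 : q != 0 by apply/eqP => qz; move: q0; rewrite qz horner0 ltxx.
move=> x; rewrite -roots_on_rootsR // in_itv /= rootE qx !mulf_eq0 !subr_eq0.
by rewrite !inE orbA.
Qed.

Section MuBounds.
Variables gA gR gK : R.
Hypotheses (gA_gt0 : 0 < gA) (gA_neq1 : gA != 1) (gR_gt0 : 0 < gR)
  (gK_gt0 : 0 < gK).

Lemma mu_a_le x : x < 0 -> 0 <= (pi_poly gA gR gK).[x] -> mu_a gA gR gK <= x.
Proof.
have [a [b [c [a0 /andP[b0 bA] Ac rE qE]]]] :=
  pi_roots gA_gt0 gA_neq1 gR_gt0 gK_gt0.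
move=> x0; rewrite qE /mu_a rE /= -mulrA pmulr_lge0 ?subr_ge0 //.
have xc := lt_trans x0 (lt_trans gA_gt0 Ac).
by rewrite nmulr_rgt0 subr_lt0 // (lt_trans x0 b0).
Qed.

Lemma mu_b_le x : 0 < x -> x < gA -> (pi_poly gA gR gK).[x] <= 0 ->
  mu_b gA gR gK <= x.
Proof.
have [a [b [c [a0 /andP[b0 bA] Ac rE qE]]]] :=
  pi_roots gA_gt0 gA_neq1 gR_gt0 gK_gt0.
move=> x0 xA; rewrite qE /mu_b rE /= nmulr_lle0 ?subr_lt0; last exact: lt_trans Ac.
by rewrite pmulr_rge0 ?subr_ge0 ?subr_gt0 //; apply: lt_trans x0.
Qed.

Lemma mu_c_ge x : gA < x -> (pi_poly gA gR gK).[x] <= 0 -> x <= mu_c gA gR gK.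
Proof.
have [a [b [c [a0 /andP[b0 bA] Ac rE qE]]]] :=
  pi_roots gA_gt0 gA_neq1 gR_gt0 gK_gt0.
move=> xA; rewrite qE /mu_c rE /= pmulr_rle0 ?subr_le0 //.
rewrite mulr_gt0 // subr_gt0; last exact: lt_trans xA.
exact: lt_trans a0 (lt_trans gA_gt0 xA).
Qed.

Lemma mu_b_lt : mu_b gA gR gK < gA.
Proof.
have [a [b [c [_ /andP[_ bA] _ rE _]]]] := pi_roots gA_gt0 gA_neq1 gR_gt0 gK_gt0.
by rewrite /mu_b rE.
Qed.

Lemma mu_c_gt : gA < mu_c gA gR gK.
Proof.
have [a [b [c [_ _ Ac rE _]]]] := pi_roots gA_gt0 gA_neq1 gR_gt0 gK_gt0.
by rewrite /mu_c rE.
Qed.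

End MuBounds.

(** The other root [h + s] is positive, so a negative [x] above [lambda_minus] would lie strictly
    between the two roots, where the quadratic is negative. *)
Lemma lambda_minus_ge gA gR x : 0 < gR -> x < 0 ->
  0 <= x ^+ 2 - (gA * gR + gA - 2 * gR) * x - gR -> x <= lambda_minus gA gR.
Proof.
move=> gR0 x0; rewrite /lambda_minus; set h := Defs.eta gA gR.
have -> : gA * gR + gA - 2 * gR = 2 * h by rewrite /h /Defs.eta; field.
have D0 : 0 <= h ^+ 2 + gR by rewrite addr_ge0 ?sqr_ge0 // ltW.
have := sqr_sqrtr D0; have := sqrtr_ge0 (h ^+ 2 + gR).
move: (Num.sqrt _) => s s0 sE qx; rewrite leNgt; apply/negP => xs.
have hs : - h < s.
  apply: ltr_normlW; rewrite normrN -(ger0_norm s0) -ltr_sqr ?nnegrE //.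
  by rewrite !real_normK ?num_real // sE ltrDl.
have : 0 < (x - h + s) * (s + h - x) by rewrite mulr_gt0; lra.
have -> : (x - h + s) * (s + h - x) = s ^+ 2 - (x - h) ^+ 2 by ring.
rewrite sE; nra.
Qed.

End Cubic.

(** * The preconditioned pencil in block form *)

Section BlockAlgebra.
Variables (R : rcfType) (n m p : nat).

Lemma mul_block3
    (M11 : 'M[R]_(n, n)) (M12 : 'M[R]_(n, m)) (M13 : 'M[R]_(n, p))
    (M21 : 'M[R]_(m, n)) (M22 : 'M[R]_(m, m)) (M23 : 'M[R]_(m, p))
    (M31 : 'M[R]_(p, n)) (M32 : 'M[R]_(p, m)) (M33 : 'M[R]_(p, p))
    (N11 : 'M[R]_(n, n)) (N12 : 'M[R]_(n, m)) (N13 : 'M[R]_(n, p))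
    (N21 : 'M[R]_(m, n)) (N22 : 'M[R]_(m, m)) (N23 : 'M[R]_(m, p))
    (N31 : 'M[R]_(p, n)) (N32 : 'M[R]_(p, m)) (N33 : 'M[R]_(p, p)) :
  block3_mx M11 M12 M13 M21 M22 M23 M31 M32 M33 *m
  block3_mx N11 N12 N13 N21 N22 N23 N31 N32 N33 =
  block3_mx
    (M11 *m N11 + M12 *m N21 + M13 *m N31) (M11 *m N12 + M12 *m N22 + M13 *m N32)
      (M11 *m N13 + M12 *m N23 + M13 *m N33)
    (M21 *m N11 + M22 *m N21 + M23 *m N31) (M21 *m N12 + M22 *m N22 + M23 *m N32)
      (M21 *m N13 + M22 *m N23 + M23 *m N33)
    (M31 *m N11 + M32 *m N21 + M33 *m N31) (M31 *m N12 + M32 *m N22 + M33 *m N32)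
      (M31 *m N13 + M32 *m N23 + M33 *m N33).
Proof.
rewrite /block3_mx !mulmx_block mul_col_row add_block_mx mul_block_col mul_col_mx.
by rewrite add_col_mx mul_row_block mul_mx_row add_row_mx mul_row_col.
Qed.

Lemma mul_block3_col
    (M11 : 'M[R]_(n, n)) (M12 : 'M[R]_(n, m)) (M13 : 'M[R]_(n, p))
    (M21 : 'M[R]_(m, n)) (M22 : 'M[R]_(m, m)) (M23 : 'M[R]_(m, p))
    (M31 : 'M[R]_(p, n)) (M32 : 'M[R]_(p, m)) (M33 : 'M[R]_(p, p))
    (x : 'cV[R]_n) (y : 'cV[R]_m) (z : 'cV[R]_p) :
  block3_mx M11 M12 M13 M21 M22 M23 M31 M32 M33 *m col_mx (col_mx x y) z =
  col_mx (col_mx (M11 *m x + M12 *m y + M13 *m z) (M21 *m x + M22 *m y + M23 *m z))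
         (M31 *m x + M32 *m y + M33 *m z).
Proof.
by rewrite /block3_mx mul_block_col mul_block_col mul_col_mx add_col_mx mul_row_col.
Qed.

Lemma tr_block3
    (M11 : 'M[R]_(n, n)) (M12 : 'M[R]_(n, m)) (M13 : 'M[R]_(n, p))
    (M21 : 'M[R]_(m, n)) (M22 : 'M[R]_(m, m)) (M23 : 'M[R]_(m, p))
    (M31 : 'M[R]_(p, n)) (M32 : 'M[R]_(p, m)) (M33 : 'M[R]_(p, p)) :
  (block3_mx M11 M12 M13 M21 M22 M23 M31 M32 M33)^T =
  block3_mx M11^T M21^T M31^T M12^T M22^T M32^T M13^T M23^T M33^T.
Proof. by rewrite /block3_mx !tr_block_mx tr_col_mx tr_row_mx. Qed.

Lemma spd_block_diag n1 n2 (M : 'M[R]_n1) (N : 'M[R]_n2) :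
  spd M -> spd N -> spd (block_mx M 0 0 N).
Proof.
move=> sM sN; split=> [|v]; first by rewrite tr_block_mx !trmx0 sM.1 sN.1.
rewrite -[v]vsubmxK; move: (usubmx v) (dsubmx v) => x y xy0.
rewrite tr_col_mx mul_row_block !mulmx0 addr0 add0r mul_row_col mxE.
have := spd_ge0 x sM; have := spd_ge0 y sN; rewrite /dot !mulmxA => yN xM.
have [x0|x0] := eqVneq x 0; last by apply: ltr_pwDl yN; apply: sM.2.
apply: ltr_wpDl xM _; apply: sN.2.
by apply: contraNneq xy0 => ->; rewrite x0 col_mx0.
Qed.

Variables (A Ah : 'M[R]_n) (Sh : 'M[R]_m) (Xh : 'M[R]_p)
  (B : 'M[R]_(m, n)) (C : 'M[R]_(p, m)).
Hypotheses (spdAh : spd Ah) (spdSh : spd Sh) (spdXh : spd Xh).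

Lemma spd_precond_D : spd (precond_D Ah Sh Xh).
Proof.
by rewrite /precond_D /block3_mx row_mx0 col_mx0; do !apply: spd_block_diag.
Qed.

(** A congruence of the inverse of [precond_D] by a block triangular matrix with invertible diagonal
    blocks. *)
Lemma spd_precond : spd (precond Ah Sh Xh B C).
Proof.
apply: spd_congr; last exact/spd_inv/spd_precond_D.
rewrite row_free_unit unitmxE /precond_L /block3_mx col_mx0 !det_lblock.
rewrite !unitrM -!unitmxE (spd_unit spdAh) (spd_unit spdXh).
by rewrite -scaleN1r unitmxZ ?unitrN1 // (spd_unit spdSh).
Qed.

Lemma precondE : precond Ah Sh Xh B C =
  block3_mx Ah B^T 0
            B (B *m invmx Ah *m B^T + Sh) (- C^T)
            0 (- C) (C *m invmx Sh *m C^T + Xh).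
Proof.
have [[uA uS] uX] := (spd_unit spdAh, spd_unit spdSh, spd_unit spdXh).
have DE : invmx (precond_D Ah Sh Xh) =
    block3_mx (invmx Ah) 0 0 0 (invmx Sh) 0 0 0 (invmx Xh).
  have uAS : block_mx Ah 0 0 Sh \in unitmx by apply/spd_unit/spd_block_diag.
  rewrite /precond_D /block3_mx row_mx0 col_mx0 !invmx_block_diag //.
  by have := spd_unit spd_precond_D; rewrite /precond_D /block3_mx row_mx0 col_mx0.
rewrite /precond DE /precond_L tr_block3 !mul_block3 !trmx0 !linearN /=.
rewrite spdAh.1 spdSh.1 spdXh.1.
rewrite !(mulmx0, mul0mx, addr0, add0r, mulNmx, mulmxN, opprK, oppr0).
by rewrite !mulmxV // !mul1mx -!mulmxA !mulVmx // !mulmx1.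
Qed.

Lemma saddle_mx_sym : A^T = A -> (saddle_mx A B C)^T = saddle_mx A B C.
Proof. by move=> sA; rewrite /saddle_mx tr_block3 sA !trmx0 !trmxK. Qed.

(** The [B] blocks are the same in both matrices, whence the factor [l - 1]; the [C] blocks have
    opposite signs, whence [1 + l]. *)
Lemma saddle_pencilE l (x : 'cV_n) (y : 'cV_m) (z : 'cV_p) :
  saddle_mx A B C *m col_mx (col_mx x y) z =
    l *: (precond Ah Sh Xh B C *m col_mx (col_mx x y) z) ->
  [/\ (A - l *: Ah) *m x = (l - 1) *: (B^T *m y),
      (1 + l) *: (C^T *m z) =
        l *: ((B *m invmx Ah *m B^T + Sh) *m y) + (l - 1) *: (B *m x) &
      (1 + l) *: (C *m y) = l *: ((C *m invmx Sh *m C^T + Xh) *m z)].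
Proof.
rewrite precondE /saddle_mx !mul_block3_col !scale_col_mx.
move=> /eq_col_mx[/eq_col_mx[]].
rewrite !(mulmx0, mul0mx, addr0, add0r, mulNmx, mulmxN).
move=> E1 E2 E3; split.
- rewrite mulmxBl -scalemxAl -[A *m x](addrK (B^T *m y)) E1.
  by apply/colP => i; rewrite !mxE; ring.
- apply/colP => i; have /colP/(_ i) := E2; rewrite !(mxE, mulmxDl) => E.
  by lra.
- apply/colP => i; have /colP/(_ i) := E3; rewrite !(mxE, mulmxDl) => E.
  by lra.
Qed.

End BlockAlgebra.

(** * Eigenvalue bounds *)

(* Throughout, [x], [y], [z] are the blocks of an eigenvector and
   [r = y^T St y], [s = y^T Sh y], [h = x^T (A - l Ah) x],
   [q = z^T (Xt + Xh) z]; the hypothesis [l q - h = l (r + s)] is the energy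
   identity of the pencil. *)
Section ScalarBounds.
Variable R : rcfType.
Implicit Types a k l r s h q : R.

Lemma pi_ge0_of_energy a r1 k l r s h q :
  a < 2 -> l < 0 -> 0 < k -> l < a -> 0 < s -> r <= r1 * s ->
  (a - l) * h <= (l - 1) ^+ 2 * r ->
  (1 + k) * (l ^+ 2 * q) <= (1 + l) ^+ 2 * k * s ->
  l * q - h = l * (r + s) -> 0 <= (pi_poly a r1 k).[l].
Proof.
move=> a2 l0 k0 la s0 rs hr qs E; rewrite horner_pi -(pmulr_lge0 _ s0).
have lq : l ^+ 2 * q = l ^+ 2 * (r + s) + l * h.
  have -> : l ^+ 2 * q = l * (l * q - h) + l * h by ring.
  by rewrite E; ring.
have c0 : l * (1 - 2 * l + a * l) < 0 by rewrite nmulr_rlt0 //; nra.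
have al0 : 0 < a - l by rewrite subr_gt0.
have k1 : 0 < 1 + k by rewrite addr_gt0.
have H1 := ler_wpM2l (ltW al0) qs.
have H2 : l * ((l - 1) ^+ 2 * r) <= l * ((a - l) * h) by rewrite ler_nM2l.
have H3 : l * (1 - 2 * l + a * l) * (r1 * s) <= l * (1 - 2 * l + a * l) * r.
  by rewrite ler_nM2l.
have H4 : (1 + k) * (l ^+ 2 * (a - l) * s + l * (1 - 2 * l + a * l) * (r1 * s))
   <= (1 + k) * ((a - l) * (l ^+ 2 * q)).
  rewrite ler_pM2l // lq.
  have -> : (a - l) * (l ^+ 2 * (r + s) + l * h) = l ^+ 2 * (a - l) * s +
    l * (1 - 2 * l + a * l) * r + (l * ((a - l) * h) - l * ((l - 1) ^+ 2 * r)).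
    by ring.
  lra.
have -> : (k * ((1 + l) ^+ 2 * (a - l)) +
   (1 + k) * ((l ^+ 2 - (a * r1 + a - 2 * r1) * l - r1) * l)) * s =
   (a - l) * ((1 + l) ^+ 2 * k * s) -
   (1 + k) * (l ^+ 2 * (a - l) * s + l * (1 - 2 * l + a * l) * (r1 * s)) by ring.
rewrite subr_ge0; apply: le_trans H4 _.
by rewrite mulrCA.
Qed.

(** The same elimination with the inequalities reversed. Only [0 <= q] is used of the multiplier
    term, so the quadratic [p] takes the place of the cubic. *)
Lemma p_ge0_of_energy a r1 l r s h q :
  a < 2 -> l < 0 -> l < a -> 0 < s -> r1 * s <= r -> 0 <= q ->
  (l - 1) ^+ 2 * r <= (a - l) * h ->
  l * q - h = l * (r + s) ->
  0 <= l ^+ 2 - (a * r1 + a - 2 * r1) * l - r1.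
Proof.
move=> a2 l0 la s0 rs q0 hr E.
have lq : l ^+ 2 * q = l ^+ 2 * (r + s) + l * h.
  have -> : l ^+ 2 * q = l * (l * q - h) + l * h by ring.
  by rewrite E; ring.
have c0 : l * (1 - 2 * l + a * l) < 0 by rewrite nmulr_rlt0 //; nra.
have al0 : 0 < a - l by rewrite subr_gt0.
have H1 : 0 <= (a - l) * (l ^+ 2 * q).
  by apply: mulr_ge0; [exact: ltW|apply: mulr_ge0 => //; exact: sqr_ge0].
have H2 : l * ((a - l) * h) <= l * ((l - 1) ^+ 2 * r) by rewrite ler_nM2l.
have H3 : l * (1 - 2 * l + a * l) * r <= l * (1 - 2 * l + a * l) * (r1 * s).
  by rewrite ler_nM2l.
have ls : l * s < 0 by rewrite nmulr_rlt0.
rewrite -(nmulr_rle0 _ ls).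
have -> : l * s * (l ^+ 2 - (a * r1 + a - 2 * r1) * l - r1) =
  - (l ^+ 2 * (a - l) * s + l * (1 - 2 * l + a * l) * (r1 * s)) by ring.
rewrite oppr_le0; apply: le_trans H1 _; rewrite lq.
have -> : (a - l) * (l ^+ 2 * (r + s) + l * h) = l ^+ 2 * (a - l) * s +
    l * (1 - 2 * l + a * l) * r + (l * ((a - l) * h) - l * ((l - 1) ^+ 2 * r)).
  by ring.
lra.
Qed.

(* The left-hand side of the energy bound is affine in [r], so one of the
   endpoints of the range of [r / s] is admissible. *)
Lemma pi_le0_of_energy a r1 r2 k l r s h q :
  0 < l -> 0 < k -> a < l -> 0 < s -> r1 * s <= r -> r <= r2 * s ->
  (l - a) * (- h) <= (l - 1) ^+ 2 * r ->
  (1 + k) * (l ^+ 2 * q) <= (1 + l) ^+ 2 * k * s ->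
  l * q - h = l * (r + s) ->
  (pi_poly a r1 k).[l] <= 0 \/ (pi_poly a r2 k).[l] <= 0.
Proof.
move=> l0 k0 al s0 rs1 rs2 hr qs E.
(* The coefficient of [r] once [h] is eliminated. It equals [l ((2 - a) l - 1)], whose sign is not
   determined by the hypotheses. *)
pose c := l * (l * (l - a) - (l - 1) ^+ 2).
have lq : l ^+ 2 * q = l ^+ 2 * (r + s) + l * h.
  have -> : l ^+ 2 * q = l * (l * q - h) + l * h by ring.
  by rewrite E; ring.
have la0 : 0 < l - a by rewrite subr_gt0.
have k1 : 0 < 1 + k by rewrite addr_gt0.
have H1 := ler_wpM2l (ltW la0) qs.
have H2 : l * ((l - a) * (- h)) <= l * ((l - 1) ^+ 2 * r) by rewrite ler_pM2l.
have concl t : c * (t * s) <= c * r -> (pi_poly a t k).[l] <= 0.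
  move=> H3; rewrite horner_pi -(pmulr_lle0 _ s0).
  have -> : (k * ((1 + l) ^+ 2 * (a - l)) +
     (1 + k) * ((l ^+ 2 - (a * t + a - 2 * t) * l - t) * l)) * s =
     (1 + k) * (l ^+ 2 * (l - a) * s + c * (t * s)) -
     (l - a) * ((1 + l) ^+ 2 * k * s) by rewrite /c; ring.
  rewrite subr_le0; apply: le_trans H1; rewrite [leRHS]mulrCA ler_pM2l // lq.
  have -> : (l - a) * (l ^+ 2 * (r + s) + l * h) = l ^+ 2 * (l - a) * s + c * r
     + (l * ((l - 1) ^+ 2 * r) - l * ((l - a) * (- h))) by rewrite /c; ring.
  lra.
have [c0|c0] := leP 0 c.
  by left; apply: concl; rewrite ler_wpM2l.
by right; apply: concl; rewrite ler_nM2l.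
Qed.

End ScalarBounds.

(** * Signs of [pi] and [p] at an eigenvalue *)

Section Pencil.
Variables (R : rcfType) (n m p : nat).
Variables (A Ah : 'M[R]_n) (Sh : 'M[R]_m) (Xh : 'M[R]_p)
  (B : 'M[R]_(m, n)) (C : 'M[R]_(p, m)).
Hypotheses (spdA : spd A) (spdAh : spd Ah) (spdSh : spd Sh) (spdXh : spd Xh)
  (fullB : row_free B) (fullC : row_free C).
Let St := B *m invmx Ah *m B^T.
Let Xt := C *m invmx Sh *m C^T.
Variables (a1 a2 r1 r2 k1 k2 : R).
Hypotheses
  (geA : forall x, a1 * dot x (Ah *m x) <= dot x (A *m x))
  (leA : forall x, dot x (A *m x) <= a2 * dot x (Ah *m x))
  (geS : forall y, r1 * dot y (Sh *m y) <= dot y (St *m y))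
  (leS : forall y, dot y (St *m y) <= r2 * dot y (Sh *m y))
  (geX : forall z, k1 * dot z (Xh *m z) <= dot z (Xt *m z))
  (leX : forall z, dot z (Xt *m z) <= k2 * dot z (Xh *m z)).
Hypotheses (a1_gt0 : 0 < a1) (a1_lt1 : a1 < 1) (a2_gt1 : 1 < a2) (a2_lt2 : a2 < 2)
  (r1_gt0 : 0 < r1) (r2_gt0 : 0 < r2) (k1_gt0 : 0 < k1) (k2_gt0 : 0 < k2).

Variables (l : R) (x : 'cV[R]_n) (y : 'cV[R]_m) (z : 'cV[R]_p).
Hypothesis v_neq0 : ~ [/\ x = 0, y = 0 & z = 0].
Let H := A - l *: Ah.
Hypotheses (E1 : H *m x = (l - 1) *: (B^T *m y))
  (E2 : (1 + l) *: (C^T *m z) = l *: ((St + Sh) *m y) + (l - 1) *: (B *m x))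
  (E3 : (1 + l) *: (C *m y) = l *: ((Xt + Xh) *m z)).

Let r := dot y (St *m y).
Let s := dot y (Sh *m y).
Let h := dot x (H *m x).
Let q := dot z ((Xt + Xh) *m z).

Let spdSt : spd St. Proof. exact/spd_congr/spd_inv. Qed.
Let spdXt : spd Xt. Proof. exact/spd_congr/spd_inv. Qed.
Let spdX : spd (Xt + Xh). Proof. exact: spdD. Qed.
Let symH : H^T = H.
Proof. by rewrite /H linearB linearZ /= spdA.1 spdAh.1. Qed.

Let formH (u : 'cV_n) : dot u (H *m u) = dot u (A *m u) - l * dot u (Ah *m u).
Proof. by rewrite /H mulmxBl -scalemxAl dotBr dotZr. Qed.

Let geH u : (a1 - l) * dot u (Ah *m u) <= dot u (H *m u).
Proof. by rewrite formH mulrBl lerB. Qed.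

Let leH u : dot u (H *m u) <= (a2 - l) * dot u (Ah *m u).
Proof. by rewrite formH mulrBl lerB. Qed.

Lemma spd_shift_lo : l < a1 -> spd H.
Proof.
move=> la; split=> // u u0; rewrite -mulmxA; apply: lt_le_trans (geH u).
by rewrite mulr_gt0 ?subr_gt0 // spd_gt0.
Qed.

Lemma spd_shift_hi : a2 < l -> spd (- H).
Proof.
move=> la; split=> [|u u0]; first by rewrite linearN /= symH.
rewrite -mulmxA -/(dot _ _) mulNmx dotNr oppr_gt0; apply: le_lt_trans (leH u) _.
by rewrite nmulr_rlt0 ?subr_lt0 // spd_gt0.
Qed.

Let rE : r = dot (B^T *m y) (invmx Ah *m (B^T *m y)).
Proof. by rewrite /r /St -!mulmxA dot_mulmx. Qed.

(** Eliminating [x] expresses [h] through [invmx H] at the vector [B^T *m y], where [r] is the form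
    of [invmx Ah]. Comparisons of [H] with [Ah] thus pass to [h] and [r] through [spd_inv_le]. *)
Let hE : H \in unitmx ->
  h = (l - 1) ^+ 2 * dot (B^T *m y) (invmx H *m (B^T *m y)).
Proof.
move=> uH; rewrite /h E1; have -> : x = (l - 1) *: (invmx H *m (B^T *m y)).
  by rewrite scalemxAr -E1 mulKmx.
by rewrite dotZl dotZr dotC mulrA.
Qed.

Lemma shift_form_le : l < a1 -> (a1 - l) * h <= (l - 1) ^+ 2 * r.
Proof.
move=> la; have sH := spd_shift_lo la; rewrite hE ?spd_unit // rE mulrCA.
apply: ler_wpM2l; first exact: sqr_ge0.
by apply: spd_inv_le => //; rewrite subr_gt0.
Qed.

Lemma shift_form_ge : l < a1 -> (l - 1) ^+ 2 * r <= (a2 - l) * h.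
Proof.
move=> la; have sH := spd_shift_lo la; rewrite hE ?spd_unit // rE [leRHS]mulrCA.
apply: ler_wpM2l; first exact: sqr_ge0.
have a2l : 0 < a2 - l by move: la a1_lt1 a2_gt1; lra.
rewrite -ler_pdivrMl //; apply: spd_inv_le => // [|u]; first by rewrite invr_gt0.
by rewrite ler_pdivrMl.
Qed.

Lemma shift_form_ge_opp : a2 < l -> (l - a2) * (- h) <= (l - 1) ^+ 2 * r.
Proof.
move=> la; have sH := spd_shift_hi la.
have uH : H \in unitmx.
  by rewrite -[H]opprK -scaleN1r unitmxZ ?unitrN1 // spd_unit.
have invN : invmx (- H) = - invmx H.
  by rewrite -[RHS](mulKmx (spd_unit sH)) mulNmx !mulmxN opprK mulmxV // mulmx1.
rewrite hE // rE -mulrN mulrCA -dotNr -mulNmx -invN.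
apply: ler_wpM2l; first exact: sqr_ge0.
apply: spd_inv_le => // [|u]; first by rewrite subr_gt0.
by rewrite mulNmx dotNr lerNr -mulNr opprB.
Qed.

(** Pair the three block equations with [x], [y] and [z]; the coupling terms in [B] and [C]
    cancel. *)
Lemma energy : l * q - h = l * (r + s).
Proof.
have Ex := congr1 (dot x) E1; have Ey := congr1 (dot y) E2.
have Ez := congr1 (dot z) E3.
move: Ex Ey Ez; rewrite /h /q /r /s mulmxDl !(dotZr, dotDr).
rewrite (dot_mulmx C^T) trmxK (dotC (C *m y)) (dot_mulmx B y) (dotC _ x).
lra.
Qed.

(** With [u = Sh^-1 C^T z], the third equation paired with [z] reads [(1 + l) u.(Sh y) = l q].
    Cauchy-Schwarz for [Sh] bounds [(l q)^2] by [(1 + l)^2 s] times [z.(Xt z)], the latter is at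
    most [k2 q / (1 + k2)], and a factor [q] cancels. *)
Lemma multiplier_bound : (1 + k2) * (l ^+ 2 * q) <= (1 + l) ^+ 2 * k2 * s.
Proof.
have q0 : 0 <= q by apply: spd_ge0.
have [->|qn0] := eqVneq q 0.
  rewrite !mulr0; apply: mulr_ge0; last exact: spd_ge0.
  by apply: mulr_ge0; [exact: sqr_ge0|exact: ltW].
have {qn0} q0 : 0 < q by rewrite lt_neqAle eq_sym qn0.
pose u := invmx Sh *m (C^T *m z).
have xtE : dot z (Xt *m z) = dot u (Sh *m u).
  by rewrite /u mulKVmx ?spd_unit // [RHS]dotC /Xt -!mulmxA dot_mulmx.
have zCy : (1 + l) * dot u (Sh *m y) = l * q.
  rewrite (dot_sym _ _ spdSh.1) mulKVmx ?spd_unit // dot_mulmx trmxK dotC.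
  by rewrite -dotZr E3 dotZr.
have cs := spd_cauchy u y spdSh; rewrite -xtE -/s in cs.
have xtq : (1 + k2) * dot z (Xt *m z) <= k2 * q.
  by rewrite /q mulmxDl dotDr; have := leX z; lra.
have s0 : 0 <= s by apply: spd_ge0.
rewrite -(ler_pM2r q0).
have -> : (1 + k2) * (l ^+ 2 * q) * q = (1 + k2) * (l * q) ^+ 2 by ring.
have -> : (1 + l) ^+ 2 * k2 * s * q = (1 + l) ^+ 2 * (k2 * (s * q)) by ring.
rewrite -zCy exprMn mulrCA.
apply: ler_wpM2l; first exact: sqr_ge0.
apply: (@le_trans _ _ ((1 + k2) * (dot z (Xt *m z) * s))).
  by rewrite ler_pM2l // addr_gt0.
rewrite mulrA; apply: le_trans (ler_wpM2r s0 xtq) _.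
by rewrite -mulrA (mulrC q).
Qed.

(** At [l = 0] the equations turn [x.(A x)] into [z.(C y) = 0], so [x = 0]; the full row ranks of
    [B] and [C] then annihilate [y] and [z]. *)
Lemma eigenvalue_neq0 : l != 0.
Proof.
apply/eqP => l0; apply: v_neq0; move: E1 E2 E3.
rewrite /H l0 !(scale0r, subr0, sub0r, scaleN1r, add0r, addr0, scale1r).
move=> F1 F2 Cy0.
have x0 : x = 0.
  apply/eqP/negPn/negP => /(spd_gt0 spdA).
  rewrite F1 dotNr dot_mulmx trmxK -[B *m x]opprK -F2 dotC dotNr dot_mulmx trmxK.
  by rewrite Cy0 dotC dot0r oppr0 oppr0 ltxx.
move: F1 F2; rewrite x0 !mulmx0 oppr0 => /esym/eqP; rewrite oppr_eq0.
move=> /eqP/(trmx_mul_row_free fullB) -> /(trmx_mul_row_free fullC) ->.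
by [].
Qed.

(** If [y = 0], the first and third equations become homogeneous with the nonsingular matrices [H]
    and [l (Xt + Xh)]. *)
Lemma middle_gt0 : (l < a1) || (a2 < l) -> 0 < s.
Proof.
move=> la; apply: spd_gt0 => //; apply/eqP => y0; apply: v_neq0.
move: E1 E3; rewrite y0 !mulmx0 !scaler0 => Hx /esym/eqP.
have uH : H \in unitmx.
  case/orP: la => [/spd_shift_lo/spd_unit//|/spd_shift_hi/spd_unit].
  by rewrite -scaleN1r unitmxZ ?unitrN1.
rewrite scaler_eq0 (negbTE eigenvalue_neq0) /= => /eqP Xz0.
split=> //; first by rewrite -[x](mulKmx uH) Hx mulmx0.
by rewrite -[z](mulKmx (spd_unit spdX)) Xz0 mulmx0.
Qed.

Lemma neg_lower : l < 0 -> 0 <= (pi_poly a1 r2 k2).[l].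
Proof.
move=> l0; have la : l < a1 by apply: lt_trans a1_gt0.
apply: (@pi_ge0_of_energy _ a1 r2 k2 l r s h q) => //.
- by move: a1_lt1; lra.
- by apply: middle_gt0; rewrite la.
- exact: leS.
- exact: shift_form_le.
- exact: multiplier_bound.
- exact: energy.
Qed.

Lemma neg_upper : l < 0 -> 0 <= l ^+ 2 - (a2 * r1 + a2 - 2 * r1) * l - r1.
Proof.
move=> l0; have la : l < a1 by apply: lt_trans a1_gt0.
apply: (@p_ge0_of_energy _ a2 r1 l r s h q) => //.
- by move: la a1_lt1 a2_gt1; lra.
- by apply: middle_gt0; rewrite la.
- exact: geS.
- exact: spd_ge0.
- exact: shift_form_ge.
- exact: energy.
Qed.

Lemma pos_upper : a2 < l ->
  (pi_poly a2 r1 k2).[l] <= 0 \/ (pi_poly a2 r2 k2).[l] <= 0.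
Proof.
move=> la; apply: (@pi_le0_of_energy _ a2 r1 r2 k2 l r s h q) => //.
- by move: la a2_gt1; lra.
- by apply: middle_gt0; rewrite la orbT.
- exact: geS.
- exact: leS.
- exact: shift_form_ge_opp.
- exact: multiplier_bound.
- exact: energy.
Qed.

(* Here [x] and then [y] are eliminated: [Y y = (1 + l) C^T z] with
   [Y = (l - 1)^2 B H^-1 B^T + l (St + Sh)], which is positive definite and at
   most [g Sh]. *)
Lemma pos_lower : 0 < l -> l < a1 -> (pi_poly a1 r2 k1).[l] <= 0.
Proof.
move=> l0 la; have sH := spd_shift_lo la; have uH := spd_unit sH.
have al0 : 0 < a1 - l by rewrite subr_gt0.
pose Y := (l - 1) ^+ 2 *: (B *m invmx H *m B^T) + l *: (St + Sh).
have sY : spd Y.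
  apply: spdD; apply: spdZ => //; last exact: spdD.
  - by rewrite exprn_even_gt0 //= subr_eq0; move: la a1_lt1; lra.
  - exact/spd_congr/spd_inv.
have Yy : Y *m y = (1 + l) *: (C^T *m z).
  rewrite E2 /Y [LHS]mulmxDl -!scalemxAl addrC; congr (_ + _).
  by rewrite -!mulmxA -[x](mulKmx uH) E1 -!scalemxAr scalerA expr2.
(* Obtained from [Y] by bounding [H^-1] by [(a1 - l)^-1 Ah^-1] and then [St] by [r2 Sh]. *)
pose g := (l - 1) ^+ 2 / (a1 - l) * r2 + l * (r2 + 1).
have g0 : 0 < g.
  rewrite /g; apply: ltr_wpDl; last by rewrite mulr_gt0 // addr_gt0.
  by apply/mulr_ge0/ltW => //; apply: divr_ge0; [exact: sqr_ge0|exact: ltW].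
have leY u : dot u (Y *m u) <= g * dot u (Sh *m u).
  rewrite /Y mulmxDl -!scalemxAl mulmxDl dotDr !dotZr dotDr.
  have E : dot u (B *m invmx H *m B^T *m u) <=
      (a1 - l)^-1 * dot u (St *m u).
    rewrite ler_pdivlMl // /St -!mulmxA !(dot_mulmx B).
    by apply: spd_inv_le.
  have c0 : 0 <= (l - 1) ^+ 2 / (a1 - l).
    by apply: divr_ge0; [exact: sqr_ge0|exact: ltW].
  have := ler_wpM2l (sqr_ge0 (l - 1)) E; rewrite mulrA.
  have := ler_wpM2l c0 (leS u); have := ler_wpM2l (ltW l0) (leS u).
  by rewrite /g; lra.
have z0 : z != 0.
  apply/eqP => z0; apply: v_neq0.
  have y0 : y = 0.
    by rewrite -[y](mulKmx (spd_unit sY)) Yy z0 mulmx0 scaler0 mulmx0.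
  by split=> //; rewrite -[x](mulKmx uH) E1 y0 mulmx0 scaler0 mulmx0.
pose xt := dot z (Xt *m z).
have xt0 : 0 < xt by apply: spd_gt0.
have xtE : xt = dot (C^T *m z) (invmx Sh *m (C^T *m z)).
  by rewrite /xt /Xt -!mulmxA dot_mulmx.
have B1 : g^-1 * xt <= dot (C^T *m z) (invmx Y *m (C^T *m z)).
  rewrite xtE; apply: spd_inv_le => // [|u]; first by rewrite invr_gt0.
  by rewrite ler_pdivrMl.
(* Substitute [y = (1 + l) Y^-1 C^T z] into the third equation paired with [z]. *)
have B2 : (1 + l) ^+ 2 * dot (C^T *m z) (invmx Y *m (C^T *m z)) = l * q.
  rewrite expr2 -mulrA -dotZr scalemxAr -Yy mulKmx ?spd_unit //.
  by rewrite dotC dot_mulmx trmxK dotC -dotZr E3 dotZr.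
have B3 : k1 * q <= (1 + k1) * xt.
  by rewrite /q mulmxDl dotDr; have := geX z; rewrite -/xt; lra.
have B4 : (1 + l) ^+ 2 * xt <= g * (l * q).
  rewrite -B2 mulrCA; apply: ler_wpM2l; first exact: sqr_ge0.
  by rewrite -ler_pdivrMl.
(* Chain [B4] with [B3] and cancel [xt]; multiplying by [a1 - l] afterwards clears the denominator
   of [g] and yields the sign of [pi]. *)
have B5 : k1 * (1 + l) ^+ 2 <= g * l * (1 + k1).
  rewrite -(ler_pM2r xt0).
  have := ler_wpM2l (ltW k1_gt0) B4.
  have := ler_wpM2l (ltW (mulr_gt0 g0 l0)) B3.
  lra.
have B6 := ler_wpM2l (ltW al0) B5.
have gE : (a1 - l) * g = (l - 1) ^+ 2 * r2 + (a1 - l) * l * (r2 + 1).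
  by rewrite /g; field; rewrite gt_eqF.
rewrite horner_pi.
have -> : k1 * ((1 + l) ^+ 2 * (a1 - l)) +
    (1 + k1) * ((l ^+ 2 - (a1 * r2 + a1 - 2 * r2) * l - r2) * l) =
   (a1 - l) * (k1 * (1 + l) ^+ 2) -
   ((l - 1) ^+ 2 * r2 + (a1 - l) * l * (r2 + 1)) * l * (1 + k1) by ring.
by rewrite -gE subr_le0; move: B6; rewrite !mulrA.
Qed.

End Pencil.

(** * Assembly of the spectral inclusion *)

Lemma spd_scalar1 (R : rcfType) n : spd (1%:M : 'M[R]_n).
Proof.
split=> [|x x0]; first exact: trmx1.
rewrite mulmx1 -/(dot x x) lt_neqAle dot_ge0 andbT eq_sym.
by apply: contraNneq x0 => /dot_eq0 ->.
Qed.

Theorem corollary2p2 (R : realType) (n m p : nat)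
    (p_gt0 : (0 < p)%N) (le_pm : (p <= m)%N) (le_mn : (m <= n)%N)
    (A : 'M[R]_n) (B : 'M[R]_(m, n)) (C : 'M[R]_(p, m))
    (spdA : spd A) (fullB : row_free B) (fullC : row_free C)
    (Ah : 'M[R]_n) (Sh : 'M[R]_m) (Xh : 'M[R]_p)
    (spdAh : spd Ah) (spdSh : spd Sh) (spdXh : spd Xh)
    (Sh_half : 'M[R]_m) (Xh_half : 'M[R]_p)
    (Sh_halfP : is_spd_sqrt Sh_half Sh) (Xh_halfP : is_spd_sqrt Xh_half Xh)
    (gAmin gAmax gRmin gRmax gKmin gKmax : R) :
  let St : 'M[R]_m := B *m invmx Ah *m B^T in
  let K : 'M[R]_(p, m) := invmx Xh_half *m C *m invmx Sh_half in
  is_min_eigenvalue (invmx Ah *m A) gAmin ->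
  is_max_eigenvalue (invmx Ah *m A) gAmax ->
  is_min_eigenvalue (invmx Sh *m St) gRmin ->
  is_max_eigenvalue (invmx Sh *m St) gRmax ->
  is_min_eigenvalue (K *m K^T) gKmin ->
  is_max_eigenvalue (K *m K^T) gKmax ->
  gAmin < 1 -> 1 < gAmax -> gAmax < 2 ->
  1 \in `[gRmin, gRmax] ->
  1 \in `[gKmin, gKmax] ->
  forall z : R[i],
    eigenvalue
      (map_mx (real_complex R)
         (invmx (precond Ah Sh Xh B C) *m saddle_mx A B C)) z ->
  exists2 x : R, z = real_complex R x &
    x \in `[mu_a gAmin gRmax gKmax, lambda_minus gAmax gRmin] \/
    x \in `[mu_b gAmin gRmax gKmin,
            Num.max (mu_c gAmax gRmin gKmax)
              (Num.max (mu_c gAmax gRmax gKmax) (beta_c gAmax gKmax))].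
Proof.
move=> St K [gA1 leA] [gA2 geA] [gR1 leR] [gR2 geR] [gK1 leK] [gK2 geK].
move=> A1 A2 A3 R1 K1 w /complex_pencil_eigenvalue.
case=> [||l -> [v v0 vE]]; first exact: spd_precond.
  exact/saddle_mx_sym/spdA.1.
exists l => //.
have [sS sX] := (Sh_halfP.1, Xh_halfP.1).
have [uS uX] := (spd_unit sS, spd_unit sX).
have ShE : invmx Sh = invmx Sh_half *m invmx Sh_half.
  by rewrite -Sh_halfP.2 -[LHS]mulmx1; apply: canLR (mulKmx _) _;
     rewrite ?unitmx_mul ?uS // -mulmxA mulKVmx // mulmxV.
pose Xt := C *m invmx Sh *m C^T.
have KE : K *m K^T = invmx Xh_half *m Xt *m (invmx Xh_half)^T.
  rewrite /K !trmx_mul (spd_inv sS).1 /Xt ShE.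
  by rewrite !mulmxA.
have spdSt : spd St by apply/spd_congr/spd_inv.
have spdXt : spd Xt by apply/spd_congr/spd_inv.
have spdK : spd (K *m K^T).
  by rewrite KE; apply: spd_congr; rewrite // row_free_unit unitmx_inv.
(* The substitution of [Xh_half *m z] carries the pair [(Xt, Xh)] to [(K K^T, 1)], so the eigenvalue
   bounds on [K K^T] become bounds of [Xt] against [Xh]. *)
have formXt z : dot z (Xt *m z) = dot (Xh_half *m z) (K *m K^T *m (Xh_half *m z)).
  rewrite KE (spd_inv sX).1 -!mulmxA mulKmx // [RHS]dot_mulmx (spd_inv sX).1.
  by rewrite mulKmx.
have formXh z : dot z (Xh *m z) = dot (Xh_half *m z) (1%:M *m (Xh_half *m z)).
  by rewrite mul1mx -Xh_halfP.2 -mulmxA dot_mulmx sX.1.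
have eigK g : eigenvalue (K *m K^T) g = eigenvalue (invmx 1%:M *m (K *m K^T)) g.
  by rewrite invmx1 mul1mx.
have A1p := spd_pencil_eigenvalue_gt0 spdAh spdA gA1.
have R1p := spd_pencil_eigenvalue_gt0 spdSh spdSt gR1.
have R2p := spd_pencil_eigenvalue_gt0 spdSh spdSt gR2.
have K1p : 0 < gKmin.
  by rewrite eigK in gK1; apply: spd_pencil_eigenvalue_gt0 gK1 => //;
     exact: spd_scalar1.
have K2p : 0 < gKmax.
  by rewrite eigK in gK2; apply: spd_pencil_eigenvalue_gt0 gK2 => //;
     exact: spd_scalar1.
have bA1 := rayleigh_ge spdAh spdA.1 leA.
have bA2 := rayleigh_le spdAh spdA.1 geA.
have bR1 := rayleigh_ge spdSh spdSt.1 leR.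
have bR2 := rayleigh_le spdSh spdSt.1 geR.
have bK1 z : gKmin * dot z (Xh *m z) <= dot z (Xt *m z).
  rewrite formXt formXh; apply: rayleigh_ge spdK.1 _ _; first exact: spd_scalar1.
  by move=> g; rewrite -eigK; apply: leK.
have bK2 z : dot z (Xt *m z) <= gKmax * dot z (Xh *m z).
  rewrite formXt formXh; apply: rayleigh_le spdK.1 _ _; first exact: spd_scalar1.
  by move=> g; rewrite -eigK; apply: geK.
rewrite -[v]vsubmxK -[usubmx v]vsubmxK in v0 vE.
move: (usubmx (usubmx v)) (dsubmx (usubmx v)) (dsubmx v) v0 vE => x y z v0.
move=> /(saddle_pencilE spdAh spdSh spdXh)[E1 E2 E3].
have xyz : ~ [/\ x = 0, y = 0 & z = 0].
  by case=> x0 y0 z0; move: v0; rewrite x0 y0 z0 !col_mx0 eqxx.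
have A2p : 0 < gAmax by apply: lt_trans A2.
have nA1 : gAmin != 1 by rewrite lt_eqF.
have nA2 : gAmax != 1 by rewrite gt_eqF.
have l0 := eigenvalue_neq0 spdA fullB fullC xyz E1 E2 E3.
rewrite !in_itv /=; have [ln|lp] : l < 0 \/ 0 < l.
  by case: (ltgtP l 0) l0; [left|right|].
- left; apply/andP; split.
    apply: mu_a_le => //.
    by apply: (neg_lower _ _ _ _ fullB fullC bA1 bA2 bR2 bK2 _ _ _ xyz E1 E2 E3).
  apply: lambda_minus_ge => //.
  by apply: (neg_upper _ _ _ _ fullB fullC bA1 bA2 bR1 _ _ _ _ xyz E1 E2 E3).
- right; apply/andP; split.
    (* For [l] at or above [gAmin] the bound is immediate from [mu_b < gAmin]; the upper end is
       treated likewise with [gAmax < mu_c]. *)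
    have [la|la] := ltP l gAmin; last exact/ltW/(lt_le_trans _ la)/mu_b_lt.
    apply: mu_b_le => //.
    by apply: (pos_lower _ _ _ fullB fullC bA1 bR2 bK1 _ _ _ xyz E1 E2 E3).
  rewrite !le_max; have [la|la] := ltP gAmax l; last first.
    by rewrite (le_trans la) // ltW // mu_c_gt.
  (* Each endpoint of the range of [gR] leads to one of the two [mu_c] terms of the maximum. *)
  have [H|H] := pos_upper spdA spdAh spdSh spdXh fullB fullC
    bA1 bA2 bR1 bR2 bK2 A2 K2p xyz E1 E2 E3 la.
    by rewrite mu_c_ge.
  by rewrite (mu_c_ge _ _ _ _ _ H) // orbT.
Qed.
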